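(* Let $m\in\mathbb{N}$, $\{l_1,\ldots,l_m\}\subset H'$, and define $\mathcal F,F:\ \mathbb{R}^n_+\to\mathbb{R}^{m\times m}$ by $$\mathcal F(\sigma)=\left(l_k(u_\sigma^{l_j})\right)_{j,k=1,\ldots,m},\qquad F(\sigma)=\left(l_k(\tilde u_\sigma^{l_j})\right)_{j,k=1,\ldots,m}.$$ Then $F$ has the following properties: (a) $F$ is infinitely often differentiable. (b) For all $\sigma\in\mathbb{R}^n_+$, $F(\sigma)\in\mathbb{S}_m$ and $F(\sigma)\succeq 0$. $F(\sigma)$ is positive definite if $l_1,\ldots,l_m\in H'$ are linearly independent. (c) $F$ is monotonically non-increasing, i.e. $$F'(\sigma)\tau\preceq 0\quad\text{for all }\sigma\in\mathbb{R}^n_+,\ 0\le\tau\in\mathbb{R}^n.$$ (d) $F$ is convex, i.e. $$F(\sigma)-F(\sigma^{(0)})\succeq F'(\sigma^{(0)})(\sigma-\sigma^{(0)})\quad\text{for all }\sigma,\sigma^{(0)}\in\mathbb{R}^n_+.$$ (e) $\mathcal F(\sigma)\succeq F(\sigma)$ for all $\sigma\in\mathbb{R}^n_+$.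
   Context: Setting: $H$ is a real Hilbert space and $H'=\mathcal L(H,\mathbb{R})$ is its dual. Let $n\in\mathbb{N}$ and let $b_0,b_1,\ldots,b_n:\ H\times H\to\mathbb{R}$ be bounded, symmetric and positive semidefinite bilinear forms. For $\sigma=(\sigma_1,\ldots,\sigma_n)\in\mathbb{R}^n$ set $$b_\sigma(u,v):=b_0(u,v)+\sum_{i=1}^n\sigma_i\, b_i(u,v).$$ With $\mathbf 1:=(1,\ldots,1)^T\in\mathbb{R}^n$, it is assumed that there are constants $\beta,C>0$ with $C\|v\|^2\ge b_{\mathbf 1}(v,v)\ge\beta\|v\|^2$ for all $v\in H$. $\mathbb{R}^n_+$ denotes the set of all $\sigma\in\mathbb{R}^n$ with all entries strictly positive; for such $\sigma$ the form $b_\sigma$ is symmetric, bounded and coercive. Let $V\subset H$ be a finite-dimensional subspace (the finite element space). For $\sigma\in\mathbb{R}^n_+$ and $l\in H'$, $u_\sigma^l\in H$ denotes the unique solution of $b_\sigma(u_\sigma^l,v)=l(v)$ for all $v\in H$, and $\tilde u_\sigma^l\in V$ denotes the unique solution of $b_\sigma(\tilde u_\sigma^l,v)=l(v)$ for all $v\in V$. Notation: ''$\le$'', ''$\ge$'' on $\mathbb{R}^n$ are elementwise. $\mathbb{S}_m\subseteq\mathbb{R}^{m\times m}$ is the set of symmetric $m\times m$ matrices, and $B\succeq A$ (equivalently $A\preceq B$) denotes the Loewner order, i.e. $B-A$ is positive semidefinite. $F'(\sigma)\tau=\sum_{i=1}^n\tau_i\frac{\partial}{\partial\sigma_i}F(\sigma)$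 is the derivative of $F$ at $\sigma$ in direction $\tau$.
   Formalization: In (b), positive definiteness of F(σ) is stated for l_1,…,l_m whose restrictions to V are linearly independent, rather than linearly independent in H', since the latter fails e.g. for V={0}. *)

(* Defs.v *)
(* MathComp / MathComp-Analysis; the real line is an arbitrary R : realType. *)
From HB Require Import structures.
From mathcomp Require Export all_boot all_order all_algebra sesquilinear.
From mathcomp Require Export all_classical all_reals all_analysis.

Export Order.TTheory GRing.Theory Num.Theory.
Export numFieldNormedType.Exports.

#[export] Set Implicit Arguments.
#[export] Unset Strict Implicit.
#[export] Unset Printing Implicit Defensive.

Local Open Scope classical_set_scope.
Local Open Scope ring_scope.

Section Hilbert.
Context {R : realType} {H : completeNormedModType R}.

(* The carrier is a Banach space; it is a Hilbert space with inner product [ip]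
   as soon as [ip] induces the norm. *)
Definition is_hilbert (ip : {dot H for idfun}) : Prop :=
  forall u : H, ip u u = `|u| ^+ 2.

Definition bounded_form (b : {symmetric H}) : Prop :=
  exists M : R, forall u v : H, `|b u v| <= M * `|u| * `|v|.

Definition psd_form (b : {symmetric H}) : Prop := forall u : H, 0 <= b u u.

Definition findim_subspace (V : set H) : Prop :=
  exists (d : nat) (e : 'I_d -> H),
    V = [set v | exists a : 'I_d -> R, v = \sum_(i < d) a i *: e i].

Section Forms.
Context {n : nat} (b : 'I_n.+1 -> {symmetric H}).

Definition form_at (sigma : 'rV[R]_n) (u v : H) : R :=
  b ord0 u v + \sum_(i < n) sigma 0 i * b (lift ord0 i) u v.

(* A solution in W of the variational problem tested against W. For
   [sigma] with positive entries and W = H, or W a finite-dimensional subspace,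
   existence and uniqueness (Lax-Milgram) make [get] return the solution; its
   value elsewhere is irrelevant. *)
Definition solution (W : set H) (sigma : 'rV[R]_n) (l : {linear H -> R^o}) : H :=
  get [set u | W u /\ forall v, W v -> form_at sigma u v = l v].

Definition measurement (W : set H) {m : nat} (l : 'I_m -> {linear H -> R^o})
    (sigma : 'rV[R]_n) : 'M[R]_m :=
  \matrix_(j < m, k < m) l k (solution W sigma (l j)).

End Forms.

(* Linear independence of the restrictions of the functionals to V, i.e. in V'.
   When V is a proper subspace, independence in H' is strictly weaker: on V = 0
   every restriction vanishes. *)
Definition lin_indep_on (V : set H) {m : nat} (l : 'I_m -> {linear H -> R^o})
    : Prop :=
  forall a : 'I_m -> R,
    (forall v, V v -> \sum_(j < m) a j * l j v = 0) -> forall j, a j = 0.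

End Hilbert.

Section Matrices.
Context {R : realType} {m : nat}.

Definition psd_mx (A : 'M[R]_m) : Prop :=
  A \is symmetricmx /\ forall x : 'cV[R]_m, 0 <= (x^T *m A *m x) 0 0.

Definition posdef_mx (A : 'M[R]_m) : Prop :=
  A \is symmetricmx /\
  forall x : 'cV[R]_m, x != 0 -> 0 < (x^T *m A *m x) 0 0.

Definition loewner_le (A B : 'M[R]_m) : Prop := psd_mx (B - A).

End Matrices.

Section Calculus.
Context {R : realType} {n : nat}.

Definition pos_orthant : set 'rV[R]_n := [set sigma | forall i, 0 < sigma 0 i].

(* On R^n, f is k.+1 times (Frechet) differentiable iff it is differentiable and
   its partial derivatives are k times differentiable. The set D is meant to be
   open, so that only the values of f on D matter. *)
Fixpoint times_differentiable_on {W : normedModType R} (k : nat)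
    (D : set 'rV[R]_n) (f : 'rV[R]_n -> W) : Prop :=
  if k is k'.+1 then
    (forall x, D x -> differentiable f x) /\
    (forall i : 'I_n, times_differentiable_on k' D ('D_('e_i) f))
  else True.

Definition smooth_on {W : normedModType R} (D : set 'rV[R]_n)
    (f : 'rV[R]_n -> W) : Prop :=
  forall k, times_differentiable_on k D f.

Definition dir_deriv {m : nat} (F : 'rV[R]_n -> 'M[R]_m) (sigma tau : 'rV[R]_n)
    : 'M[R]_m :=
  \sum_(i < n) tau 0 i *: 'D_('e_i) F sigma.

End Calculus.

Notation "A ⪯ B" := (loewner_le A B) (at level 70, no associativity).

(* Main.v *)
From HB Require Import structures.
Require Import Defs.
From mathcomp Require Import ring lra.

(** For [x] in [R^m] put [l_x = \sum_j x_j l_j]. By the Ritz principle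
    [x^T F(sigma) x = max_(v in V) (2 l_x(v) - b_sigma(v, v))], the maximum being
    attained at the solution [u] with load [l_x], where it equals
    [b_sigma(u, u)]. Each [x^T F x] is thus a maximum of affine functions of
    [sigma], and enlarging [V] to [H] only increases it; this gives (d) and (e).
    The affine function belonging to the maximiser at [sigma] touches [x^T F x]
    from below, so [x^T (d_i F)(sigma) x = - b_i(u, u)] (envelope theorem), which
    gives (c). In a basis of [V], [F = L A(sigma)^-1 L^T] with [A] affine in
    [sigma] and invertible on the orthant, hence [F] is smooth. *)

Local Open Scope classical_set_scope.
Local Open Scope ring_scope.

(** * Calculus *)

(** The first-order expansion of [f] at [x] is one of [g] as well; uniqueness of the differential
    then identifies ['d g x] with ['d f x]. *)
Lemma near_eq_differentiable (R : realType) (U W : normedModType R)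
    (f g : U -> W) (x : U) :
  (\near x, f x = g x) -> differentiable f x -> differentiable g x.
Proof.
move=> fg /diff_locallyP[dfc dfE].
have dgE : g \o shift x = cst (g x) + 'd f x +o_ 0 id.
  have fg0 : \forall h \near (0 : U), f (h + x) = g (h + x).
    have := fg; rewrite (near_shift 0 x)/=.
    by apply: filterS => h; rewrite /= subr0.
  move: dfE => /eqaddoP dfE; apply/eqaddoP => e /dfE.
  apply: filterS2 fg0 => h fgh.
  by rewrite !fctE /= fgh (nbhs_singleton fg).
by apply/diff_locallyP; rewrite (diff_unique dfc dgE).
Qed.

(** * Closure of k-fold differentiability under algebraic operations *)

Section TimesDifferentiable.
Context {R : realType} {n : nat} (D : set 'rV[R]_n).
Implicit Types W : normedModType R.
Context (D_open : open D).

Lemma near_in_open x : D x -> \near x, D x.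
Proof. by move=> Dx; apply: open_nbhs_nbhs. Qed.

(** Since [D] is open, derivatives at its points see only values on [D]. This allows partial
    derivatives to be replaced by closed formulas valid on [D] alone. *)
Lemma times_differentiable_ext W k (f g : 'rV[R]_n -> W) :
  (forall x, D x -> f x = g x) ->
  times_differentiable_on k D f -> times_differentiable_on k D g.
Proof.
elim: k f g => //= k IH f g fg [df Df].
have nfg x : D x -> \near x, f x = g x.
  by move=> /near_in_open; apply: filterS.
split=> [x Dx|i]; first exact: near_eq_differentiable (nfg x Dx) (df x Dx).
by apply: IH (Df i) => x Dx; apply/near_eq_derive/nfg.
Qed.

Lemma times_differentiableW W k (f : 'rV[R]_n -> W) :
  times_differentiable_on k.+1 D f -> times_differentiable_on k D f.
Proof.
elim: k f => //= k IH f [df Df]; split=> // i.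
by apply: IH; apply: Df.
Qed.

Lemma times_differentiable_cst W k (w : W) :
  times_differentiable_on k D (cst w : 'rV[R]_n -> W).
Proof.
elim: k w => //= k IH w; split=> [x _|i]; first exact: differentiable_cst.
apply: times_differentiable_ext (IH 0) => x _; by rewrite derive_cst.
Qed.

Lemma times_differentiableD W k (f g : 'rV[R]_n -> W) :
  times_differentiable_on k D f -> times_differentiable_on k D g ->
  times_differentiable_on k D (f + g).
Proof.
elim: k f g => //= k IH f g [df Df] [dg Dg]; split=> [x Dx|i].
  by apply: differentiableD; [exact: df|exact: dg].
apply: times_differentiable_ext (IH _ _ (Df i) (Dg i)) => x Dx.
by rewrite deriveD//; apply: diff_derivable; [exact: df|exact: dg].
Qed.

(** The Leibniz rule involves [f] and [g] undifferentiated, so the induction also needs them at the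
    lower order. *)
Lemma times_differentiableM k (f g : 'rV[R]_n -> R) :
  times_differentiable_on k D f -> times_differentiable_on k D g ->
  times_differentiable_on k D (f * g).
Proof.
elim: k f g => //= k IH f g /[dup] /times_differentiableW fk [df Df].
move=> /[dup] /times_differentiableW gk [dg Dg]; split=> [x Dx|i].
  by apply: differentiableM; [exact: df|exact: dg].
apply: times_differentiable_ext
  (times_differentiableD (IH _ _ fk (Dg i)) (IH _ _ gk (Df i))) => x Dx.
by rewrite deriveM//; apply: diff_derivable; [exact: df|exact: dg].
Qed.

(** The derivative of [1/f] is [-1 * (1/f * 1/f) * f'], a product of factors already known to be [k]
    times differentiable. *)
Lemma times_differentiableV k (f : 'rV[R]_n -> R) :
  (forall x, D x -> f x != 0) ->
  times_differentiable_on k D f ->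
  times_differentiable_on k D (fun x => (f x)^-1).
Proof.
move=> f0; elim: k f f0 => //= k IH f f0 /[dup] /times_differentiableW fk [df Df].
split=> [x Dx|i]; first exact: differentiableV (df x Dx) (f0 x Dx).
have Vk := IH f f0 fk.
have ck : times_differentiable_on k D (cst (-1) : 'rV[R]_n -> R).
  exact: times_differentiable_cst.
apply: times_differentiable_ext
  (times_differentiableM ck (times_differentiableM
    (times_differentiableM Vk Vk) (Df i))) => x Dx.
rewrite deriveV ?f0//; last exact/diff_derivable/df.
by rewrite !fctE mulN1r scaleNr expr2 -invfM.
Qed.

Lemma times_differentiableZl W k (f : 'rV[R]_n -> R) (w : W) :
  times_differentiable_on k D f ->
  times_differentiable_on k D (fun x => f x *: w).
Proof.
elim: k f => //= k IH f [df Df]; split=> [x Dx|i].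
  by apply: differentiableZl; exact: df.
apply: times_differentiable_ext (IH _ (Df i)) => x Dx.
rewrite !deriveE; [|exact/differentiableZl/df|exact: df].
by rewrite diffZl//; exact: df.
Qed.

Lemma times_differentiable_sum W k (I : Type) (r : seq I) (P : pred I)
    (f : I -> 'rV[R]_n -> W) :
  (forall i, P i -> times_differentiable_on k D (f i)) ->
  times_differentiable_on k D (fun x => \sum_(i <- r | P i) f i x).
Proof.
move=> fk; suff : times_differentiable_on k D (\sum_(i <- r | P i) f i).
  by apply: times_differentiable_ext => x _; rewrite fct_sumE.
elim/big_ind : _ => //; first exact: (times_differentiable_cst k 0).
by move=> ? ?; apply: times_differentiableD.
Qed.

Lemma times_differentiable_prod k (I : Type) (r : seq I) (P : pred I)
    (f : I -> 'rV[R]_n -> R) :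
  (forall i, P i -> times_differentiable_on k D (f i)) ->
  times_differentiable_on k D (fun x => \prod_(i <- r | P i) f i x).
Proof.
move=> fk; suff : times_differentiable_on k D (\prod_(i <- r | P i) f i).
  by apply: times_differentiable_ext => x _; rewrite fct_prodE.
elim/big_ind : _ => //; first exact: (times_differentiable_cst k (1 : R)).
by move=> ? ?; apply: times_differentiableM.
Qed.

Lemma times_differentiable_coord k (i : 'I_n) :
  times_differentiable_on k D (fun x : 'rV[R]_n => x 0 i).
Proof.
case: k => //= k; split=> [x _|j]; first exact: differentiable_coord.
apply: times_differentiable_ext (times_differentiable_cst k (('e_j : 'rV[R]_n) 0 i)) => x _.
have dx : differentiable (id : 'rV[R]_n -> 'rV[R]_n) x by [].
have := derive_mx (@diff_derivable _ _ _ id x 'e_j dx); rewrite derive_id.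
by move=> /matrixP/(_ 0 i); rewrite [in RHS]mxE.
Qed.

Lemma times_differentiable_det k p (A : 'rV[R]_n -> 'M[R]_p) :
  (forall i j, times_differentiable_on k D (fun x => A x i j)) ->
  times_differentiable_on k D (fun x => \det (A x)).
Proof.
move=> Ak; apply: times_differentiable_sum => s _.
apply: (@times_differentiableM _ (cst _)); first exact: times_differentiable_cst.
exact: times_differentiable_prod.
Qed.

(** Cramer's rule: the entries of the inverse are cofactors divided by the determinant. *)
Lemma times_differentiable_invmx k p (A : 'rV[R]_n -> 'M[R]_p) :
  (forall x, D x -> A x \in unitmx) ->
  (forall i j, times_differentiable_on k D (fun x => A x i j)) ->
  forall i j, times_differentiable_on k D (fun x => invmx (A x) i j).
Proof.
move=> Au Ak i j.
have dk : times_differentiable_on k D (fun x => (\det (A x))^-1).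
  apply: times_differentiableV; last exact: times_differentiable_det.
  by move=> x /Au; rewrite unitmxE unitfE.
suff ck : times_differentiable_on k D (fun x => cofactor (A x) j i).
  apply: times_differentiable_ext (times_differentiableM dk ck) => x Dx.
  by rewrite /invmx Au// !mxE.
apply: (@times_differentiableM _ (cst _)); first exact: times_differentiable_cst.
apply: times_differentiable_det => a c.
by apply: times_differentiable_ext (Ak (lift j a) (lift i c)) => x _; rewrite !mxE.
Qed.

Lemma times_differentiable_mx k p q (A : 'rV[R]_n -> 'M[R]_(p, q)) :
  (forall i j, times_differentiable_on k D (fun x => A x i j)) ->
  times_differentiable_on k D A.
Proof.
move=> Ak.
apply: (@times_differentiable_ext _ _
  (fun x => \sum_i \sum_j A x i j *: delta_mx i j)).
  by move=> x _; rewrite -matrix_sum_delta.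
by do 2![apply: times_differentiable_sum => ? _]; apply: times_differentiableZl.
Qed.

End TimesDifferentiable.

(** * First-order conditions at a local minimum *)

Lemma derive_ge0_min (R : realType) (U : normedModType R) (f : U -> R) (x v : U) :
  derivable f x v -> (\forall y \near x, f x <= f y) -> 0 <= 'D_v f x.
Proof.
move=> fx fmin.
have line : \forall h \near (0 : R), f x <= f (h *: v + x).
  have /(_ _ fmin) : (h *: v + x) @[h --> (0 : R)] --> x.
    rewrite -[X in _ --> X](add0r x) -(scale0r v).
    by apply: cvgD; [apply: cvgZr_tmp; exact: cvg_id|exact: cvg_cst].
  by [].
(* Only the limit from the right is taken: for [h > 0] the difference quotient has the sign of the
   increment of [f]. *)
rewrite /derive cvg_at_rightE//.
apply: limr_ge.
  rewrite -(cvg_at_rightE (fun h => h^-1 *: ((f \o shift x) (h *: v) - f x)))//.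
  apply: cvg_trans fx; apply: cvg_app.
  by move=> A [e egt0 Ae]; exists e => // y ye ygt0; apply: Ae => //; exact/lt0r_neq0.
near=> h.
apply: mulr_ge0; first by rewrite invr_ge0 ltW.
rewrite subr_ge0 /=.
by near: h; apply: cvg_within line.
Unshelve. all: by end_near. Qed.

(** The one-sided condition is used for [v] and [- v]; the differential is linear, so both signs
    bind the same number. *)
Lemma derive_eq0_min (R : realType) (U : normedModType R) (f : U -> R) (x v : U) :
  differentiable f x -> (\forall y \near x, f x <= f y) -> 'D_v f x = 0.
Proof.
move=> fx fmin; apply/eqP; rewrite eq_le derive_ge0_min ?andbT//; last exact: diff_derivable.
have := derive_ge0_min (@diff_derivable _ _ _ _ _ (-v) fx) fmin.
by rewrite !deriveE// linearN oppr_ge0.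
Qed.

(** * Symmetric forms and the Lax-Milgram theorem *)

Section Form.
Context {R : realType} {H : completeNormedModType R} {n : nat}.
Context (b : 'I_n.+1 -> {symmetric H}).

(** This fact and the next ones make [form_at b sigma] itself a symmetric form, so that all results
    on [{symmetric H}] apply to it. *)
Fact form_at_isZmodl sigma u' : zmod_morphism ((form_at b sigma)^~ u').
Proof.
move=> u v; rewrite /form_at linearBl opprD addrACA -sumrB.
by congr (_ + _); apply: eq_bigr => i _; rewrite linearBl mulrBr.
Qed.

Fact form_atC sigma u v : form_at b sigma u v = (-1) ^+ false * idfun (form_at b sigma v u).
Proof.
rewrite /form_at expr0 mul1r /=; congr (_ + _); first by rewrite hermC expr0 mul1r.
by apply: eq_bigr => i _; rewrite hermC expr0 mul1r.
Qed.

Fact form_at_isZmodr sigma u : zmod_morphism (form_at b sigma u).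
Proof.
by move=> v w; rewrite !(form_atC sigma u) expr0 !mul1r /= form_at_isZmodl.
Qed.

Fact form_at_scalel sigma u' : scalable_for *%R ((form_at b sigma)^~ u').
Proof.
move=> a u; rewrite /form_at linearZl_LR mulrDr mulr_sumr.
by congr (_ + _); apply: eq_bigr => i _; rewrite linearZl_LR mulrCA.
Qed.

Fact form_at_scaler sigma u : scalable_for (idfun \; *%R) (form_at b sigma u).
Proof.
by move=> a v; rewrite !(form_atC sigma u) expr0 !mul1r /= form_at_scalel.
Qed.

HB.instance Definition _ sigma := isBilinear.Build R H H R *%R (idfun \; *%R)
  (form_at b sigma) (form_at_isZmodl sigma) (form_at_isZmodr sigma)
  (form_at_scalel sigma) (form_at_scaler sigma).

HB.instance Definition _ sigma := isHermitianSesquilinear.Build R H false idfun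
  (form_at b sigma) (form_atC sigma).

End Form.

Section SymmetricForm.
Context {R : realType} {H : completeNormedModType R} (g : {symmetric H}).

Lemma symmetric_formC u v : g u v = g v u.
Proof. by rewrite hermC expr0 mul1r. Qed.

Lemma symmetric_formDD u v : g (u + v) (u + v) = g u u + g v v + 2 * g u v.
Proof. by rewrite hnormD expr0 mul1r/= mulr_natl mulr2n. Qed.

Lemma symmetric_formBB u v : g (u - v) (u - v) = g u u + g v v - 2 * g u v.
Proof. by rewrite hnormB expr0 mul1r/= mulr_natl mulr2n. Qed.

Lemma symmetric_formZl a u v : g (a *: u) v = a * g u v.
Proof. exact: linearZl_LR. Qed.

Lemma symmetric_formZr a u v : g u (a *: v) = a * g u v.
Proof. exact: linearZr_LR. Qed.

Lemma symmetric_formZZ a u : g (a *: u) (a *: u) = a ^+ 2 * g u u.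
Proof. by rewrite symmetric_formZl symmetric_formZr mulrA. Qed.

Definition coercive_form := exists2 alpha : R, 0 < alpha &
  forall v, alpha * `|v| ^+ 2 <= g v v.

Lemma coercive_form_psd : coercive_form -> psd_form g.
Proof.
by move=> [a a0 ga] v; apply: le_trans (ga v); rewrite mulr_ge0 ?sqr_ge0 ?ltW.
Qed.

Lemma coercive_form_eq0 v : coercive_form -> g v v <= 0 -> v = 0.
Proof.
move=> [a a0 /(_ v) ga] gv; apply/normr0_eq0/eqP.
rewrite -sqrf_eq0 eq_le sqr_ge0 andbT -(pmulr_rle0 _ a0).
exact: le_trans gv.
Qed.

(** * The Lax-Milgram theorem by energy minimisation *)

Section LaxMilgram.
Context (l : {linear H -> R^o}).
Context (g_bounded : bounded_form g) (g_coercive : coercive_form)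
  (l_continuous : continuous l).

Let J v : R := g v v - 2 * l v.

Let lZ a v : l (a *: v) = a * l v.
Proof. exact: linearZ. Qed.

(** With coercivity constant [a] and Lipschitz constant [k] of [l], [a * J v + k ^+ 2] is at least
    the square of [a * |v| - k]. *)
Let J_bounded : has_lbound (range J).
Proof.
have [k k0 lk] := linear_lipschitz l_continuous; have [a a0 ga] := g_coercive.
exists (- (k ^+ 2 / a)) => _ [v _ <-]; rewrite /J.
have lv : l v <= k * `|v| := le_trans (ler_norm _) (lk v).
have := sqr_ge0 (a * `|v| - k); have := ga v => gv sq.
suff : 0 <= a * (g v v - 2 * l v) + k ^+ 2.
  move=> h; rewrite -(ler_pM2l a0) mulrN mulrCA divff ?gt_eqF// mulr1; lra.
have : a * (a * `|v| ^+ 2) <= a * g v v by rewrite ler_pM2l.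
have : a * l v <= a * (k * `|v|) by rewrite ler_pM2l.
move: sq; rewrite sqrrB exprMn => *; nra.
Qed.

Let J_inf v : inf (range J) <= J v.
Proof. by apply: ge_inf => //; exists v. Qed.

Let almost_stationary v e w : J v <= inf (range J) + e ->
  (g v w - l w) ^+ 2 <= e * g w w.
Proof.
move=> Jv; have [-> | w0] := eqVneq w 0.
  by rewrite linear0r linear0 linear0r subrr expr0n mulr0.
have gw : 0 < g w w.
  rewrite lt_neqAle (coercive_form_psd g_coercive) andbT eq_sym.
  by apply: contraNneq w0 => gw; apply/eqP/(coercive_form_eq0 g_coercive); rewrite gw.
(* [t] minimises [t ^+ 2 * g w w + 2 * (t * c)], the change of [J] from [v] to [v + t *: w], which
   is at least [- e]. *)
set c := g v w - l w; set t := - c / g w w.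
have := le_trans Jv (lerD (J_inf (v + t *: w)) (lexx e)).
rewrite /J symmetric_formDD symmetric_formZZ linearD lZ linearZr_LR/= => h.
have {h} : 0 <= t ^+ 2 * g w w + 2 * (t * c) + e by rewrite /c; lra.
move/(ler_wpM2l (ltW gw)); rewrite mulr0.
have -> : g w w * (t ^+ 2 * g w w + 2 * (t * c) + e) = e * g w w - c ^+ 2.
  by rewrite /t; field; rewrite gt_eqF.
by rewrite subr_ge0.
Qed.

(* A minimising sequence of [J] is Cauchy by the parallelogram identity, and by
   [almost_stationary] its limit is stationary. *)
Lemma lax_milgram : exists u, forall w, g u w = l w.
Proof.
have infJ : has_inf (range J) by split=> //; exists (J 0), 0.
have /choice[v vJ] : forall k : nat, exists v, J v <= inf (range J) + k.+1%:R^-1.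
  move=> k; have k0 : 0 < k.+1%:R^-1 :> R by rewrite invr_gt0.
  by have [_ [v _ <-] /ltW vk] := inf_adherent k0 infJ; exists v.
have [a a0 ga] := g_coercive.
(* The linear terms cancel: [g] at [v N - v k] is [2 J (v N) + 2 J (v k)] minus four times [J] at
   the midpoint. Each of the first two exceeds twice the infimum by at most [2 / (N + 1)]. *)
have dist N k : (N <= k)%N -> a * `|v N - v k| ^+ 2 <= 4 * N.+1%:R^-1.
  move=> Nk; apply: le_trans (ga _) _.
  have kN : k.+1%:R^-1 <= N.+1%:R^-1 :> R by rewrite lef_pV2 ?posrE// ler_nat.
  have := J_inf (2^-1 *: (v N + v k)); have := vJ N; have := vJ k.
  rewrite /J symmetric_formZZ symmetric_formDD symmetric_formBB lZ linearD/=.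
  by move: N.+1%:R^-1 k.+1%:R^-1 (inf _) kN => eN ek I *; lra.
have /cauchy_cvg/cvg_ex[u vu] : cauchy (v @ \oo).
  apply: cauchy_exP => e e0.
  (* Once [1 / (N + 1)] is below this threshold, [dist] yields a distance below [e]. *)
  have ae : 0 < a * e ^+ 2 / 4 by rewrite divr_gt0// mulr_gt0// exprn_gt0.
  have [N _ Ne] := near_infty_natSinv_lt (PosNum ae).
  exists (v N); exists N => // k /= Nk; rewrite -ball_normE/=.
  rewrite -(@ltr_pXn2r _ 2)// ?nnegrE ?(ltW e0)// -(ltr_pM2l a0).
  apply: le_lt_trans (dist N k Nk) _.
  by have := Ne N (leqnn N); rewrite /= ltr_pdivlMr // mulrC.
exists u => w; apply/eqP; rewrite -subr_eq0 -sqrf_eq0 eq_le sqr_ge0 andbT.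
have [M gM] := g_bounded.
(* A bound on the squared residual of [u], from [(x + y)^2 <= 2 x^2 + 2 y^2] with
   [x = g (u - v k) w] and [y] the residual of [v k]; it tends to 0. *)
pose f k : R := 2 * (M * `|u - v k| * `|w|) ^+ 2 + 2 * (k.+1%:R^-1 * g w w).
have uv : `|u - v k| @[k --> \oo] --> (0 : R).
  by apply/norm_cvg0P; rewrite -(subrr u); apply: cvgB => //; exact: cvg_cst.
have f0 : f @ \oo --> 2 * (M * 0 * `|w|) ^+ 2 + 2 * (0 * g w w).
  apply: cvgD; [apply: cvgMl_tmp|exact: cvgMl_tmp (cvgMr_tmp cvg_harmonic)].
  have h0 : M * `|u - v k| * `|w| @[k --> \oo] --> M * 0 * `|w|.
    by apply: cvgMr_tmp; apply: cvgMl_tmp.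
  exact: (@continuous_cvg _ _ _ _ _ _ (fun x : R => x ^+ 2) _ (@exprn_continuous R 2 _) h0).
rewrite !(mulr0, mul0r, expr0n, addr0) in f0.
apply: (cvgr_to_ge f0).
near=> k; rewrite /f.
have := almost_stationary w (vJ k).
have : (g (u - v k) w) ^+ 2 <= (M * `|u - v k| * `|w|) ^+ 2.
  by rewrite -(real_normK (num_real (g _ w))) lerXn2r ?nnegrE// (le_trans _ (gM _ _)).
have -> : g (u - v k) w = g u w - g (v k) w by exact: linearBl.
move: (M * _ * _) (_^-1 * _) => X Y.
have := sqr_ge0 (g u w - g (v k) w - (g (v k) w - l w)).
rewrite !expr2; move: (g u w) (g (v k) w) (l w) => p q r; nra.
Unshelve. all: by end_near. Qed.

End LaxMilgram.
End SymmetricForm.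

(** * The measurement matrix *)

Lemma pos_orthant_open (R : realType) (n : nat) :
  open (pos_orthant : set 'rV[R]_n).
Proof.
rewrite openE => x x0.
apply: (@filter_forall _ _ (fun i (y : 'rV[R]_n) => 0 < y 0 i) (nbhs x)) => i.
exact: (@coord_continuous _ _ _ 0 i x _ (lt_nbhsr (x0 i))).
Qed.

(** * Differentiation through entries of matrix products *)

Section MatrixCalculus.
Context {R : realType} {U : normedModType R} {m n p q : nat}.
Context (P : 'M[R]_(p, m)) (Q : 'M[R]_(n, q)) (i : 'I_p) (j : 'I_q).

(** Continuous and linear in [M], so it commutes with differentiation. With [P = x^T] and [Q = x] it
    is the quadratic form of [M] at [x]. *)
Let entry (M : 'M[R]_(m, n)) : R^o := (P *m M *m Q) i j.

Let entry_is_linear : linear entry.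
Proof.
by move=> a M N; rewrite /entry mulmxDr mulmxDl -scalemxAr -scalemxAl !mxE.
Qed.

Let entry_continuous : continuous entry.
Proof.
move=> M; apply/differentiable_continuous.
have -> : entry = \sum_l \sum_k (P i k * Q l j) *: (fun N : 'M[R]_(m, n) => N k l : R^o).
  apply/funext => N; rewrite /entry mxE fct_sumE; apply: eq_bigr => l _.
  rewrite mxE fct_sumE mulr_suml; apply: eq_bigr => k _.
  by rewrite /GRing.scale/= mulrAC.
by apply: differentiable_sum => ?; apply: differentiable_sum => ?; apply/differentiableZ/differentiable_coord.
Qed.

HB.instance Definition _ := GRing.isLinear.Build R 'M[R]_(m, n) R^o *:%R entry entry_is_linear.

Lemma differentiable_mulmx_entry (F : U -> 'M[R]_(m, n)) x :
  differentiable F x -> differentiable (fun s => (P *m F s *m Q) i j : R) x.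
Proof.
move=> Fx; apply: (@differentiable_comp _ _ _ _ F entry) => //.
exact: linear_differentiable.
Qed.

Lemma derive_mulmx_entry (F : U -> 'M[R]_(m, n)) x v :
  differentiable F x ->
  'D_v (fun s => (P *m F s *m Q) i j : R) x = (P *m 'D_v F x *m Q) i j.
Proof.
move=> Fx; rewrite deriveE ?deriveE//; last exact: differentiable_mulmx_entry.
rewrite (@diff_comp _ _ _ _ F entry)//=; last exact: linear_differentiable.
by rewrite (@diff_lin _ _ _ entry).
Qed.

End MatrixCalculus.

Lemma symmetricmxP (R : realType) m (M : 'M[R]_m) :
  reflect (forall i j, M i j = M j i) (M \is symmetricmx).
Proof.
apply: (iffP (is_hermitianmxP _ _ _)); rewrite expr0 scale1r => MT.
  by move=> i j; rewrite {1}MT !mxE.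
by apply/matrixP => i j; rewrite !mxE.
Qed.

Lemma quad_mxE (R : realType) m (M : 'M[R]_m) (x : 'cV[R]_m) :
  (x^T *m M *m x) 0 0 = \sum_j \sum_k x j 0 * x k 0 * M j k.
Proof.
rewrite mxE exchange_big/=; apply: eq_bigr => k _; rewrite mxE mulr_suml.
by apply: eq_bigr => j _; rewrite !mxE mulrAC.
Qed.

(** * Weak solutions, the Ritz principle and the envelope formula *)

Section Forms.
Context {R : realType} {H : completeNormedModType R} {n : nat}.
Context (b : 'I_n.+1 -> {symmetric H}).

Lemma form_atB sigma tau u v :
  form_at b sigma u v - form_at b tau u v =
  \sum_(i < n) (sigma - tau) 0 i * b (lift ord0 i) u v.
Proof.
rewrite /form_at opprD addrACA subrr add0r -sumrB.
by apply: eq_bigr => i _; rewrite !mxE mulrBl.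
Qed.

Lemma form_at_bounded sigma :
  (forall i, bounded_form (b i)) -> bounded_form (form_at b sigma).
Proof.
move=> /choice[M bM]; exists (M ord0 + \sum_(i < n) `|sigma 0 i| * M (lift ord0 i)).
move=> u v; apply: le_trans (ler_normD _ _) _.
rewrite !mulrDl lerD//; apply: le_trans (ler_norm_sum _ _ _) _.
rewrite !mulr_suml ler_sum// => i _.
by rewrite normrM -!mulrA ler_wpM2l// mulrA.
Qed.

(** As the [b i] are positive semidefinite, [b_sigma] dominates [c] times the form at the all-ones
    vector, where [c] is the least of the [sigma 0 i] and of 1, the weight of [b ord0]. *)
Lemma form_at_coercive (beta : R) sigma : 0 < beta ->
  (forall i, psd_form (b i)) ->
  (forall v, beta * `|v| ^+ 2 <= form_at b (const_mx 1) v v) ->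
  pos_orthant sigma -> coercive_form (form_at b sigma).
Proof.
move=> beta0 b_psd b1 sigma0; pose c := \big[Num.min/1]_(i < n) sigma 0 i.
have c0 : 0 < c by apply: lt_bigmin.
exists (c * beta) => [|v]; first exact: mulr_gt0.
rewrite -mulrA; apply: le_trans (ler_wpM2l (ltW c0) (b1 v)) _.
rewrite /form_at mulrDr lerD//.
  by rewrite ler_piMl ?b_psd//; exact: bigmin_le_id.
rewrite mulr_sumr ler_sum// => i _; rewrite mxE mul1r ler_wpM2r ?b_psd//.
exact: bigmin_le.
Qed.

Definition linear_subspace (W : set H) := W 0 /\ forall a u v, W u -> W v -> W (a *: u + v).

Lemma linear_subspace_sum W (I : finType) (x : I -> R) (u : I -> H) :
  linear_subspace W -> (forall i, W (u i)) -> W (\sum_i x i *: u i).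
Proof.
move=> [W0 WP] Wu; elim: (index_enum I) => [|i r IH]; first by rewrite big_nil.
by rewrite big_cons; apply: WP.
Qed.

(** The load is a plain function, so that [fun v => \sum_j x j 0 * l j v] can serve as one. *)
Definition weak_solution (W : set H) sigma (l : H -> R) (u : H) :=
  W u /\ forall v, W v -> form_at b sigma u v = l v.

Lemma solutionP W sigma (l : {linear H -> R^o}) :
  (exists u, weak_solution W sigma l u) ->
  weak_solution W sigma l (solution b W sigma l).
Proof. exact: getPex. Qed.

(** The difference of two solutions lies in [W]; tested with itself it has zero energy. *)
Lemma weak_solution_unique W sigma (l : H -> R) u v :
  linear_subspace W -> coercive_form (form_at b sigma) ->
  weak_solution W sigma l u -> weak_solution W sigma l v -> u = v.
Proof.
move=> [_ WP] coer [Wu lu] [Wv lv]; apply/subr0_eq/(coercive_form_eq0 coer).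
have Wuv : W (u - v) by rewrite addrC -scaleN1r; apply: WP.
by rewrite linearBl/= lu// lv// subrr.
Qed.

Section Measurement.
Context (W : set H) {m : nat} (l : 'I_m -> {linear H -> R^o}).
Context (W_subspace : linear_subspace W).
Implicit Types (x : 'cV[R]_m) (s sigma tau : 'rV[R]_n).

(** By linearity, the solution with load [l_x]. *)
Definition superpose sigma (x : 'cV[R]_m) : H :=
  \sum_j x j 0 *: solution b W sigma (l j).

Section FixedSigma.
Context (sigma : 'rV[R]_n).
Context (coer : coercive_form (form_at b sigma)).
Context (sol : forall j, exists u, weak_solution W sigma (l j) u).

(** The equation for load [l k] is tested with the solution for load [l j]. *)
Lemma measurementE j k : measurement b W l sigma j k =
  form_at b sigma (solution b W sigma (l j)) (solution b W sigma (l k)).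
Proof.
have [Wj _] := solutionP (sol j); have [Wk lk] := solutionP (sol k).
by rewrite mxE -lk// symmetric_formC.
Qed.

Lemma superpose_solution x :
  weak_solution W sigma (fun v => \sum_j x j 0 * l j v) (superpose sigma x).
Proof.
split=> [|v Wv].
  by apply: linear_subspace_sum => // j; have [] := solutionP (sol j).
rewrite linear_sumlz; apply: eq_bigr => j _; rewrite linearZl_LR/=.
by have [_ ->] := solutionP (sol j).
Qed.

Lemma measurement_quad x : (x^T *m measurement b W l sigma *m x) 0 0 =
  form_at b sigma (superpose sigma x) (superpose sigma x).
Proof.
rewrite quad_mxE /superpose linear_sumlz; apply: eq_bigr => j _.
rewrite linear_sumr; apply: eq_bigr => k _.
by rewrite measurementE/= symmetric_formZl symmetric_formZr mulrA.
Qed.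

Lemma measurement_sym : measurement b W l sigma \is symmetricmx.
Proof. by apply/symmetricmxP => j k; rewrite !measurementE symmetric_formC. Qed.

(** Expand [b_sigma(u - v, u - v) >= 0] for the solution [u] with load [l_x], using
    [b_sigma(u, v) = l_x(v)]. *)
Lemma measurement_ritz x v : W v ->
  2 * (\sum_j x j 0 * l j v) - form_at b sigma v v <=
  (x^T *m measurement b W l sigma *m x) 0 0.
Proof.
move=> Wv; rewrite measurement_quad -(superpose_solution x).2//.
have := coercive_form_psd coer (superpose sigma x - v).
by rewrite symmetric_formBB/= => *; lra.
Qed.

Lemma measurement_psd : psd_mx (measurement b W l sigma).
Proof.
split=> [|x]; first exact: measurement_sym.
by rewrite measurement_quad; apply: (coercive_form_psd coer).
Qed.

(** If the quadratic form is not positive at [x], the solution with load [l_x] is zero, so [l_x]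
    vanishes on [W] and independence there gives [x = 0]. *)
Lemma measurement_posdef :
  lin_indep_on W l -> posdef_mx (measurement b W l sigma).
Proof.
move=> indep; split=> [|x x0]; first exact: measurement_sym.
rewrite measurement_quad ltNge; apply: contra x0 => /(coercive_form_eq0 coer) ux.
apply/eqP/matrixP => j c; rewrite ord1 [RHS]mxE.
apply: (indep (fun j => x j 0)) => v Wv.
by rewrite -(superpose_solution x).2// ux linear0l.
Qed.

End FixedSigma.

(** The solution at [sigma0] is a trial vector in the Ritz bound at [sigma]. *)
Lemma measurement_tangent sigma sigma0 x :
  coercive_form (form_at b sigma) ->
  (forall j, exists u, weak_solution W sigma (l j) u) ->
  (forall j, exists u, weak_solution W sigma0 (l j) u) ->
  (x^T *m measurement b W l sigma0 *m x) 0 0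
    - \sum_(i < n) (sigma - sigma0) 0 i *
        b (lift ord0 i) (superpose sigma0 x) (superpose sigma0 x) <=
  (x^T *m measurement b W l sigma *m x) 0 0.
Proof.
move=> coer sol sol0; have [Wu lu] := superpose_solution sol0 x.
apply: le_trans (measurement_ritz coer sol x Wu).
by rewrite -lu// measurement_quad// -form_atB; lra.
Qed.

Context (D : set 'rV[R]_n) (D_open : open D).
Context (coer : forall sigma, D sigma -> coercive_form (form_at b sigma)).
Context (sol : forall sigma, D sigma ->
  forall j, exists u, weak_solution W sigma (l j) u).
Context (diff : forall sigma, D sigma -> differentiable (measurement b W l) sigma).

Lemma measurement_derive_quad sigma x i : D sigma ->
  (x^T *m 'D_('e_i) (measurement b W l) sigma *m x) 0 0 =
  - b (lift ord0 i) (superpose sigma x) (superpose sigma x).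
Proof.
move=> Ds; set u := superpose sigma x.
pose bu : 'cV[R]_n := \col_k b (lift ord0 k) u u.
pose q (s : 'rV[R]_n) : R := (x^T *m measurement b W l s *m x) 0 0.
(* The [s]-dependent part of [b_s(u, u)] with [u] frozen, written as a matrix product so that
   [derive_mulmx_entry] applies. *)
pose a (s : 'rV[R]_n) : R := (1%:M *m s *m bu) 0 0.
have aE s : a s = \sum_k s 0 k * b (lift ord0 k) u u.
  by rewrite /a mul1mx mxE; apply: eq_bigr => k _; rewrite [bu _ _]mxE.
have dq : differentiable q sigma := differentiable_mulmx_entry _ _ _ _ (diff Ds).
have did : differentiable (id : 'rV[R]_n -> 'rV[R]_n) sigma by [].
have da : differentiable a sigma := differentiable_mulmx_entry _ _ _ _ did.
(* [q + a] is minimal at [sigma], by [measurement_tangent]. *)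
have : 'D_('e_i) (q + a) sigma = 0.
  apply: derive_eq0_min; first exact: differentiableD.
  apply: filterS (near_in_open D_open Ds) => s s0.
  have := measurement_tangent x (coer s0) (sol s0) (sol Ds).
  rewrite -/u !fctE/= !aE -/(q _) -/(q _).
  under [X in _ - X <= _]eq_bigr do rewrite !mxE mulrBl.
  by rewrite sumrB; lra.
have -> : 'D_('e_i) (q + a) sigma = 'D_('e_i) q sigma + 'D_('e_i) a sigma.
  by apply: deriveD; exact: diff_derivable.
have -> : 'D_('e_i) q sigma = (x^T *m 'D_('e_i) (measurement b W l) sigma *m x) 0 0.
  exact: (derive_mulmx_entry _ _ _ _ _ (diff Ds)).
have -> : 'D_('e_i) a sigma = (('e_i : 'rV[R]_n) *m bu) 0 0.
  by rewrite /a (derive_mulmx_entry _ _ _ _ _ did) derive_id mul1mx.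
rewrite [X in _ + X]mxE => /eqP; rewrite addr_eq0 => /eqP->.
rewrite (bigD1 i)//= big1 ?addr0 => [|k /negPf ki].
  by rewrite !mxE !eqxx mul1r.
by rewrite mxE ki andbF mul0r.
Qed.

Lemma measurement_derive_sym sigma i : D sigma ->
  'D_('e_i) (measurement b W l) sigma \is symmetricmx.
Proof.
move=> Ds; apply/symmetricmxP => j k.
rewrite derive_mx; last exact/diff_derivable/diff.
rewrite !mxE; apply: near_eq_derive; apply: filterS (near_in_open D_open Ds) => s s0.
rewrite (measurementE (sol s0)) (measurementE (sol s0)); exact: symmetric_formC.
Qed.

Lemma dir_deriv_measurement_quad sigma tau x : D sigma ->
  (x^T *m dir_deriv (measurement b W l) sigma tau *m x) 0 0 =
  - \sum_(i < n) tau 0 i * b (lift ord0 i) (superpose sigma x) (superpose sigma x).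
Proof.
move=> Ds; rewrite /dir_deriv mulmx_sumr mulmx_suml summxE -sumrN.
apply: eq_bigr => i _; rewrite -scalemxAr -scalemxAl mxE.
by rewrite measurement_derive_quad// mulrN.
Qed.

Lemma dir_deriv_measurement_sym sigma tau : D sigma ->
  dir_deriv (measurement b W l) sigma tau \is symmetricmx.
Proof.
move=> Ds; apply/symmetricmxP => j k; rewrite !summxE; apply: eq_bigr => i _.
by rewrite !mxE (symmetricmxP _ (measurement_derive_sym i Ds)).
Qed.

End Measurement.
End Forms.

(** * Galerkin spaces *)

Section FiniteDimensional.
Context {R : realType} {H : completeNormedModType R}.

Definition linear_combination d (e : 'I_d -> H) (a : 'rV[R]_d) : H :=
  \sum_i a 0 i *: e i.

Lemma findim_subspace_free_basis (V : set H) : findim_subspace V ->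
  exists (d : nat) (e : 'I_d -> H),
    V = range (linear_combination e) /\
    forall a, linear_combination e a = 0 -> a = 0.
Proof.
have rangeE d (e : 'I_d -> H) :
    [set v | exists a : 'I_d -> R, v = \sum_(i < d) a i *: e i] =
    range (linear_combination e).
  apply/seteqP; split=> [v [a ->]|_ [a _ <-]]; last by exists (a 0).
  by exists (\row_i a i) => //; apply: eq_bigr => i _; rewrite mxE.
case=> d [e ->]; rewrite rangeE {rangeE}; elim: d e => [|d IH] e.
  by exists 0%N, e; split=> // a _; apply/matrixP => i [].
have [free|] := pselect (forall a, linear_combination e a = 0 -> a = 0).
  by exists d.+1, e.
move=> /existsNP[a /not_implyP[ea0 /eqP]].
rewrite -subr_eq0 subr0 => /rV0Pn[i ai0].
have ei : e i = \sum_(j < d) (- (a 0 (lift i j) / a 0 i)) *: e (lift i j).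
  apply: (scalerI ai0); rewrite scaler_sumr.
  move/eqP: ea0; rewrite /linear_combination (bigD1_ord i)//= addr_eq0 => /eqP ->.
  rewrite -sumrN; apply: eq_bigr => j _.
  by rewrite scalerA mulrN scaleNr mulrCA divff ?mulr1.
have [k [f [fE f0]]] := IH (e \o lift i).
exists k, f; split=> //; rewrite -fE; apply/seteqP; split=> _ [c _ <-].
  (* Coefficients after substituting [ei] for [e i]; the converse inclusion pads with 0 at [i]. *)
  exists (\row_j (c 0 (lift i j) - c 0 i * (a 0 (lift i j) / a 0 i))) => //.
  rewrite /linear_combination [RHS](bigD1_ord i)//= ei scaler_sumr -big_split/=.
  by apply: eq_bigr => j _; rewrite mxE scalerA -scalerDl mulrN addrC.
exists (\row_j (if unlift i j is Some j' then c 0 j' else 0)) => //.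
rewrite /linear_combination (bigD1_ord i)//= mxE unlift_none scale0r add0r.
by apply: eq_bigr => j _; rewrite mxE liftK.
Qed.

Lemma linear_combination_subspace d (e : 'I_d -> H) :
  linear_subspace (range (linear_combination e)).
Proof.
split; first by exists 0 => //; rewrite /linear_combination big1// => i _; rewrite mxE scale0r.
move=> t _ _ [a _ <-] [c _ <-]; exists (t *: a + c) => //.
rewrite /linear_combination scaler_sumr -big_split/=; apply: eq_bigr => i _.
by rewrite !mxE scalerDl scalerA.
Qed.

Context {n : nat} (b : 'I_n.+1 -> {symmetric H}).
Context {d : nat} (e : 'I_d -> H).

(** The stiffness matrix [A(sigma)]. *)
Definition gram_mx (sigma : 'rV[R]_n) : 'M[R]_d :=
  \matrix_(i, j) form_at b sigma (e i) (e j).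

Lemma form_at_gram sigma a c :
  form_at b sigma (linear_combination e a) (linear_combination e c) =
  (a *m gram_mx sigma *m c^T) 0 0.
Proof.
rewrite /linear_combination linear_sumr mxE; apply: eq_bigr => k _.
rewrite /= symmetric_formZr linear_sumlz !mxE mulrC mulr_suml mulr_suml.
by apply: eq_bigr => i _; rewrite /= symmetric_formZl !mxE.
Qed.

(** A kernel vector is the coefficient row of an element of zero energy. *)
Lemma gram_unit sigma : (forall a, linear_combination e a = 0 -> a = 0) ->
  coercive_form (form_at b sigma) -> gram_mx sigma \in unitmx.
Proof.
move=> e_free coer; rewrite unitmxE unitfE; apply/det0P => -[a /eqP a0 aG].
apply/a0/e_free/(coercive_form_eq0 coer).
by rewrite /= form_at_gram aG mul0mx mxE.
Qed.

Context {m : nat} (l : 'I_m -> {linear H -> R^o}).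

Definition load_mx : 'M[R]_(m, d) := \matrix_(j, i) l j (e i).

(** Coefficients are rows, so the Galerkin system reads [c *m gram_mx sigma = row j load_mx]. *)
Lemma galerkin_solution sigma j : gram_mx sigma \in unitmx ->
  weak_solution b (range (linear_combination e)) sigma (l j)
    (linear_combination e (row j (load_mx *m invmx (gram_mx sigma)))).
Proof.
move=> Gu; split=> [|_ [c _ <-]]; first by exists (row j (load_mx *m invmx (gram_mx sigma))).
rewrite form_at_gram -!row_mul mulmxKV// [LHS]mxE [LHS]mxE [RHS]linear_sum.
by apply: eq_bigr => i _; rewrite !mxE linearZ/= [RHS]mulrC.
Qed.

Lemma measurement_gram sigma :
  (forall a, linear_combination e a = 0 -> a = 0) ->
  coercive_form (form_at b sigma) ->
  measurement b (range (linear_combination e)) l sigma =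
  load_mx *m invmx (gram_mx sigma) *m load_mx^T.
Proof.
move=> e_free coer; have Gu := gram_unit e_free coer.
apply/matrixP => j k; rewrite !mxE.
have sj := galerkin_solution j Gu.
rewrite (weak_solution_unique (linear_combination_subspace e) coer
  (solutionP (ex_intro _ _ sj)) sj).
by rewrite linear_sum; apply: eq_bigr => i _; rewrite linearZ/= !mxE.
Qed.

Lemma smooth_measurement (D : set 'rV[R]_n) : open D ->
  (forall a, linear_combination e a = 0 -> a = 0) ->
  (forall sigma, D sigma -> coercive_form (form_at b sigma)) ->
  smooth_on D (measurement b (range (linear_combination e)) l).
Proof.
move=> D_open e_free coer k.
have Ginv := times_differentiable_invmx D_open (k := k)
  (fun s Ds => gram_unit e_free (coer s Ds)).
have {}Ginv i j : times_differentiable_on k D (fun s => invmx (gram_mx s) i j).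
  apply: Ginv => i' j'.
  apply: (@times_differentiable_ext _ _ _ D_open _ _ (cst (b ord0 (e i') (e j')) +
    fun s => \sum_(t < n) s 0 t *: (b (lift ord0 t) (e i') (e j') : R^o))).
    by move=> s _; rewrite mxE.
  apply: times_differentiableD => //; first exact: times_differentiable_cst.
  apply: times_differentiable_sum => // t _.
  by apply: times_differentiableZl => //; exact: times_differentiable_coord.
apply: (@times_differentiable_ext _ _ _ D_open _ _
  (fun s => load_mx *m invmx (gram_mx s) *m load_mx^T)).
  by move=> s Ds; rewrite measurement_gram//; exact: coer.
apply: times_differentiable_mx => // j j'.
apply: (@times_differentiable_ext _ _ _ D_open _ _
  (fun s => \sum_t \sum_i invmx (gram_mx s) i t *: (load_mx j i * load_mx j' t : R^o))).
  move=> s _; rewrite [RHS]mxE; apply: eq_bigr => t _; rewrite [X in _ = X * _]mxE mulr_suml.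
  by apply: eq_bigr => i _; rewrite [load_mx^T _ _]mxE /GRing.scale/=; ring.
do 2![apply: times_differentiable_sum => // ? _].
exact: times_differentiableZl.
Qed.

End FiniteDimensional.

(** * Properties (a) to (e) of the Galerkin measurement map *)

Theorem lemma5 (R : realType) (H : completeNormedModType R)
    (ip : {dot H for idfun}) (n : nat) (b : 'I_n.+1 -> {symmetric H})
    (beta C : R) (V : set H) (m : nat) (l : 'I_m -> {linear H -> R^o})
    (H_hilbert : is_hilbert ip)
    (b_bounded : forall i, bounded_form (b i))
    (b_psd : forall i, psd_form (b i))
    (beta_gt0 : 0 < beta) (C_gt0 : 0 < C)
    (b1_bounds : forall v : H,
       beta * `|v| ^+ 2 <= form_at b (const_mx 1) v v <= C * `|v| ^+ 2)
    (V_findim : findim_subspace V)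
    (l_continuous : forall j, continuous (l j)) :
  let calF : 'rV[R]_n -> 'M[R]_m := measurement b setT l in
  let F : 'rV[R]_n -> 'M[R]_m := measurement b V l in
  [/\ (* (a) *)
      smooth_on pos_orthant F,
      (* (b) *)
      forall sigma : 'rV[R]_n, pos_orthant sigma ->
        [/\ F sigma \is symmetricmx, 0 ⪯ F sigma
          & lin_indep_on V l -> posdef_mx (F sigma)],
      (* (c) *)
      forall sigma tau : 'rV[R]_n, pos_orthant sigma -> (forall i, 0 <= tau 0 i) ->
        dir_deriv F sigma tau ⪯ 0,
      (* (d) *)
      forall sigma sigma0 : 'rV[R]_n, pos_orthant sigma -> pos_orthant sigma0 ->
        dir_deriv F sigma0 (sigma - sigma0) ⪯ F sigma - F sigma0
    & (* (e) *)
      forall sigma : 'rV[R]_n, pos_orthant sigma -> F sigma ⪯ calF sigma].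
Proof.
move=> calF F; have [d [e [VE e_free]]] := findim_subspace_free_basis V_findim.
have coer (s : 'rV[R]_n) : pos_orthant s -> coercive_form (form_at b s).
  by apply: (form_at_coercive beta_gt0 b_psd) => v; have /andP[] := b1_bounds v.
have V_sub : linear_subspace V by rewrite VE; exact: linear_combination_subspace.
have F_smooth : smooth_on pos_orthant F.
  rewrite /F VE.
  by apply: smooth_measurement => //; exact: pos_orthant_open.
have F_diff s : pos_orthant s -> differentiable F s by have [+ _] := F_smooth 1%N; apply.
have solV s : pos_orthant s -> forall j, exists u, weak_solution b V s (l j) u.
  move=> s0 j; rewrite VE; eexists; apply: galerkin_solution.
  exact: gram_unit (coer s s0).
have symB (A B : 'M[R]_m) : A \is symmetricmx -> B \is symmetricmx -> A - B \is symmetricmx.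
  move=> /symmetricmxP As /symmetricmxP Bs; apply/symmetricmxP => i j.
  by rewrite !mxE As Bs.
have quadB (A B : 'M[R]_m) (x : 'cV[R]_m) : (x^T *m (A - B) *m x) 0 0 =
    (x^T *m A *m x) 0 0 - (x^T *m B *m x) 0 0.
  by rewrite mulmxBr mulmxBl [LHS]mxE [X in _ + X]mxE.
have sym0 : (0 : 'M[R]_m) \is symmetricmx by apply/symmetricmxP => i j; rewrite !mxE.
have Fsym s (s0 : pos_orthant s) : F s \is symmetricmx := measurement_sym (solV s s0).
have dsym s tau (s0 : pos_orthant s) : dir_deriv F s tau \is symmetricmx :=
  dir_deriv_measurement_sym (@pos_orthant_open _ _) solV F_diff tau s0.
have dquad s tau x (s0 : pos_orthant s) :=
  dir_deriv_measurement_quad V_sub (@pos_orthant_open _ _) coer solV F_diff tau x s0.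
split=> //.
- move=> s s0; split; first exact: Fsym.
    by rewrite /loewner_le subr0; exact: measurement_psd (coer s s0) (solV s s0).
  exact: measurement_posdef (coer s s0) (solV s s0).
- move=> s tau s0 tau0; split=> [|x]; first exact/symB/dsym.
  rewrite sub0r mulmxN mulNmx mxE dquad// opprK.
  by apply: sumr_ge0 => i _; rewrite mulr_ge0// b_psd.
- move=> s t s0 t0; split=> [|x].
    by apply: (symB _ _ _ (dsym _ _ t0)); apply: symB; exact: Fsym.
  (* At each [x], (d) is the tangent inequality at [t]. *)
  rewrite !quadB dquad//.
  have := measurement_tangent V_sub x (coer s s0) (solV s s0) (solV t t0).
  by rewrite -/F => *; lra.
- move=> s s0.
  (* On [V] existence came from inverting [gram_mx]; on all of [H] it comes from Lax-Milgram. *)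
  have sT j : exists u, weak_solution b setT s (l j) u.
    have [u ul] := lax_milgram (form_at_bounded s b_bounded) (coer s s0) (l_continuous j).
    by exists u; split=> // v _; exact: ul.
  split=> [|x]; first by apply: symB; [exact: (measurement_sym sT)|exact: Fsym].
  rewrite quadB subr_ge0.
  have [Vu lu] := superpose_solution V_sub (solV s s0) x.
  have T_sub : linear_subspace (@setT H) by [].
  (* The Galerkin solution [u] is a trial vector in [H], where [2 * l_x(u) - b_s(u, u) = b_s(u, u)]
     is the quadratic form of [F s] at [x]. *)
  have := measurement_ritz T_sub (coer s s0) sT x (I : setT (superpose b V l s x)).
  rewrite -lu// (measurement_quad (solV s s0)); apply: le_trans; lra.
Qed.
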